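(* Let $Z\subseteq\mathbb N$ be a dense simple set with $0\notin Z$, let $a_0<a_1<a_2<\cdots$ be the elements of $\mathbb N\setminus Z$ in ascending order, and define $x\,\zeta\,y$ iff there is an $n$ with $a_n\le\min\{x,y\}\le\max\{x,y\}<a_{n+1}$. Then $\zeta$ is a positive equivalence relation, there is a confidently learnable $\zeta$-family, and there is no finitely learnable $\zeta$-family.
   Context: A set $Z$ is dense simple if it is recursively enumerable, coinfinite, and the ascending enumeration $a_0<a_1<\cdots$ of its complement grows faster than every recursive function (for every recursive $f$, $a_n>f(n)$ for almost all $n$). A positive equivalence relation is an equivalence relation on $\mathbb{N}$ that is recursively enumerable (as a set of pairs) and has infinitely many equivalence classes. A set is $\zeta$-closed if it is a union of $\zeta$-classes. A $\zeta$-family is an infinite family of $\zeta$-closed sets possessing a uniformly r.e. one-one numbering $B_0,B_1,\dots$ (i.e. $\{\langle k,x\rangle:x\in B_k\}$ is r.e. and $B_i\neq B_j$ for $i\ne j$). $W_0,W_1,\dots$ is a fixed acceptable numbering of the r.e. sets. A text for $L$ is a total $T:\mathbb N\to\mathbb N\cup\{\#\}$ whose range minus $\{\#\}$ is $L$; $T[n]$ is its initial segment of length $n$. A learner is a recursive function $M$ from finite sequences over $\mathbb N\cup\{\#\}$ to $\mathbb N\cup\{?\}$; an output $e$ is interpreted as the hypothesis ''the $\zeta$-closure of $W_e$''. A family $\mathcal C$ is confidently learnable if some $M$, on every text $T$ for every $L\in\mathcal C$, outputs from some point on a single index whose hypothesis equals $L$, and moreover on every text for every set $L\subseteq\mathbb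 N$ the sequence $M(T[n])$ converges; finitely learnable if some $M$, on every text $T$ for every $L\in\mathcal C$, has an $n$ with $M(T[m])=?$ for all $m<n$, $M(T[j])=M(T[n])$ for all $j\ge n$, and the hypothesis of $M(T[n])$ equal to $L$. *)

(* Defs.v *)
From Stdlib Require Export RelationClasses.
From mathcomp Require Export all_boot.
From mathcomp Require Export boolp classical_sets cardinality.

Set Implicit Arguments.
Unset Strict Implicit.
Unset Printing Implicit Defensive.

Local Open Scope classical_set_scope.
Local Open Scope nat_scope.

(* Recursive functions: the smallest class of total functions containing the
   initial functions and closed under composition, primitive recursion and
   regular minimization (minimization whose search always succeeds). *)
Inductive recursive : forall k, (k.-tuple nat -> nat) -> Prop :=
| rec_zero k : @recursive k (fun=> 0)
| rec_succ : @recursive 1 (fun v => (thead v).+1)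
| rec_proj k (i : 'I_k) : @recursive k (fun v => tnth v i)
| rec_comp k m (g : m.-tuple nat -> nat) (h : 'I_m -> k.-tuple nat -> nat)
    (f : k.-tuple nat -> nat) :
    recursive g -> (forall i, recursive (h i)) ->
    (forall v, f v = g [tuple h i v | i < m]) ->
    recursive f
| rec_prim k (g : k.-tuple nat -> nat) (h : k.+2.-tuple nat -> nat)
    (f : k.+1.-tuple nat -> nat) :
    recursive g -> recursive h ->
    (forall v : k.-tuple nat, f [tuple of 0 :: v] = g v) ->
    (forall n (v : k.-tuple nat), f [tuple of n.+1 :: v] =
                 h [tuple of n :: f [tuple of n :: v] :: v]) ->
    recursive f
| rec_mu k (g : k.+1.-tuple nat -> nat) (f : k.-tuple nat -> nat) :
    recursive g ->
    (forall v : k.-tuple nat, g [tuple of f v :: v] = 0) ->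
    (forall (v : k.-tuple nat) n, n < f v -> g [tuple of n :: v] <> 0) ->
    recursive f.

(* Recursiveness transported along the coding [pickle].  It is only used for
   types built from [nat] by products, options and sequences, on which
   [pickle] is an explicit primitive recursive coding:
     pickle n = n, pickle (x, y) = CodeSeq.code [:: pickle x; pickle y],
     pickle None = 0, pickle (Some x) = 2 ^ pickle x,
     pickle s = CodeSeq.code (map pickle s). *)
Definition computable (A B : countType) (f : A -> B) : Prop :=
  exists g : nat -> nat,
    recursive (fun v : 1.-tuple nat => g (thead v)) /\
    forall x, pickle (f x) = g (pickle x).

Definition re (A : countType) (X : set A) : Prop :=
  X = set0 \/ exists2 f : nat -> A, computable f & range f = X.

Definition uniformly_re (V : nat -> set nat) : Prop :=
  re [set p : nat * nat | V p.1 p.2].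

(* Every uniformly r.e. sequence of sets, hence every r.e. set, is effectively
   translated into the numbering [W]. *)
Definition acceptable_numbering (W : nat -> set nat) : Prop :=
  uniformly_re W /\
  forall V, uniformly_re V ->
    exists2 f : nat -> nat, computable f & forall e, V e = W (f e).

Definition ascending_enumeration (a : nat -> nat) (A : set nat) : Prop :=
  {homo a : m n / m < n} /\ range a = A.

Definition dense_simple (Z : set nat) : Prop :=
  [/\ re Z,
      infinite_set (~` Z) &
      exists2 a, ascending_enumeration a (~` Z) &
        forall f : nat -> nat, computable f ->
          exists N, forall n, N <= n -> f n < a n].

Definition eq_classes (zeta : nat -> nat -> Prop) : set (set nat) :=
  [set C | exists x, C = [set y | zeta x y]].

Definition positive_equivalence (zeta : nat -> nat -> Prop) : Prop :=
  [/\ Equivalence zeta,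
      re [set p : nat * nat | zeta p.1 p.2] &
      infinite_set (eq_classes zeta)].

Definition zeta_closed (zeta : nat -> nat -> Prop) (A : set nat) : Prop :=
  exists2 F : set (set nat), F `<=` eq_classes zeta & A = \bigcup_(C in F) C.

Definition zeta_closure (zeta : nat -> nat -> Prop) (A : set nat) : set nat :=
  [set y | exists2 x, A x & zeta x y].

Definition zeta_family (zeta : nat -> nat -> Prop) (C : set (set nat)) : Prop :=
  [/\ infinite_set C,
      forall L, C L -> zeta_closed zeta L &
      exists B : nat -> set nat,
        [/\ uniformly_re B, injective B & range B = C]].

(* [None] stands for the pause symbol # in texts and for ? in the output of
   learners. *)
Definition text := nat -> option nat.

Definition text_for (T : text) (L : set nat) : Prop :=
  [set x | exists n, T n = Some x] = L.

Definition initial_segment (T : text) (n : nat) : seq (option nat) :=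
  mkseq T n.

Definition learner := seq (option nat) -> option nat.

Definition hypothesis (W : nat -> set nat) (zeta : nat -> nat -> Prop)
    (e : nat) : set nat := zeta_closure zeta (W e).

Definition confidently_learnable (W : nat -> set nat) (zeta : nat -> nat -> Prop)
    (C : set (set nat)) : Prop :=
  exists M : learner,
    [/\ computable M,
        forall L T, C L -> text_for T L ->
          exists e n, (forall j, n <= j -> M (initial_segment T j) = Some e) /\
                      hypothesis W zeta e = L &
        forall L T, text_for T L ->
          exists o n, forall j, n <= j -> M (initial_segment T j) = o].

Definition finitely_learnable (W : nat -> set nat) (zeta : nat -> nat -> Prop)
    (C : set (set nat)) : Prop :=
  exists M : learner,
    computable M /\
    forall L T, C L -> text_for T L ->
      exists n e,
        [/\ forall m, m < n -> M (initial_segment T m) = None,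
            forall j, n <= j ->
              M (initial_segment T j) = M (initial_segment T n),
            M (initial_segment T n) = Some e &
            hypothesis W zeta e = L].

(* Main.v *)
(** The [zeta]-classes are the intervals [[a n, a n.+1)]; the boundaries are
    the elements outside [Z], so that enumerating [Z] merges adjacent classes.

    For the confidently learnable family, a number [e] whose class has least
    element [a n] is assigned the union of the [e - a n + 1] consecutive classes
    starting with its own.  Merging classes only enlarges this set, whence
    uniform enumerability, and [n] together with the number of classes
    determines [e].  A learner reads [n] off the least datum, which stabilises
    on every nonempty text; after that only the finitely many members of the
    [n]-th class are candidates for [e], and the number of classes met by the
    data selects one of them monotonically.

    Conversely, let [B] number a finitely learnable family.  The finite part of
    an enumeration of [B e] on which the learner makes its first conjecture is
    contained in no [B e'] with [e' <> e].  If the parts of all [e <= 2 ^ k] lie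
    below [a k], then these [2 ^ k + 1] sets are already distinguished by which
    of the first [k] classes they contain, which is absurd.  A recursive bound
    on these parts thus contradicts the domination property of [a]. *)

Require Import Defs.
From mathcomp Require Import zify.

Set Implicit Arguments.
Unset Strict Implicit.
Unset Printing Implicit Defensive.

Local Open Scope classical_set_scope.
Local Open Scope nat_scope.

(** * Recursive functions of an environment *)

(* A context of [k] variables is a sequence of length [k], with [nth 0 v i] the
   [i]-th variable and a bound variable pushed in front: the body of a binder
   is a function of [nth 0 w 0] and [behead w]. *)
Definition rec_in k (f : seq nat -> nat) : Prop :=
  recursive (fun v : k.-tuple nat => f v).

Lemma rec_in_ext k f g :
  (forall v, size v = k -> f v = g v) -> rec_in k f -> rec_in k g.
Proof.
move=> fg; rewrite /rec_in; congr (recursive _).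
by apply: funext => v; apply: fg; rewrite size_tuple.
Qed.

Lemma rec_in_comp m k (f : seq nat -> nat) (h : nat -> seq nat -> nat) :
  rec_in m f -> (forall i, i < m -> rec_in k (h i)) ->
  rec_in k (fun v => f (mkseq (h^~ v) m)).
Proof.
move=> rf rh; apply: (rec_comp rf (h := fun (i : 'I_m) v => h i v)) => [i|v].
  exact: rh.
congr (f _); apply: (@eq_from_nth _ 0); first by rewrite size_mkseq size_tuple.
move=> i; rewrite size_mkseq => im.
by rewrite nth_mkseq // -[i]/(val (Ordinal im)) -tnth_nth tnth_mktuple.
Qed.

(** The [d] applications of [behead] are what [d] enclosing binders leave in front of a variable, so
    the lemma matches terms as they arise. *)
Lemma rec_var d k i : i + d < k ->
  rec_in k (fun v => nth 0 (iter d behead v) i).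
Proof.
move=> idk; have [ik dk] : i + d < k /\ 0 < k by lia.
apply: (@rec_in_ext k (fun v => nth 0 v (i + d))) => [v _|].
  by elim: d i {idk ik} => [|d IHd] i; rewrite ?addn0 //= nth_behead -IHd addSnnS.
have -> : (fun v : seq nat => nth 0 v (i + d)) =
          (fun v => nth 0 v (Ordinal ik)) by [].
rewrite /rec_in; have -> : (fun v : k.-tuple nat => nth 0 v (Ordinal ik)) =
   (fun v => tnth v (Ordinal ik)) by apply: funext => v; rewrite (tnth_nth 0).
exact: rec_proj.
Qed.

(** * Closure under arithmetic and bounded search *)

Definition Rec1 (F : nat -> nat) := forall k f,
  rec_in k f -> rec_in k (fun v => F (f v)).
Definition Rec2 (F : nat -> nat -> nat) := forall k f g,
  rec_in k f -> rec_in k g -> rec_in k (fun v => F (f v) (g v)).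
Definition Rec3 (F : nat -> nat -> nat -> nat) := forall k f g h,
  rec_in k f -> rec_in k g -> rec_in k h ->
  rec_in k (fun v => F (f v) (g v) (h v)).

Lemma Rec1I F : rec_in 1 (fun v => F (nth 0 v 0)) -> Rec1 F.
Proof.
by move=> rF k f rf; apply: (rec_in_comp (h := fun _ => f)) rF _ => -[].
Qed.

Lemma Rec2I F : rec_in 2 (fun v => F (nth 0 v 0) (nth 0 v 1)) -> Rec2 F.
Proof.
move=> rF k f g rf rg.
by apply: (rec_in_comp (h := fun i v => if i is 0 then f v else g v)) rF _ => -[|[]].
Qed.

Lemma Rec1_succ : Rec1 succn.
Proof.
apply: Rec1I; have := rec_succ; rewrite /rec_in; congr (recursive _).
by apply: funext => v; rewrite /thead (tnth_nth 0).
Qed.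

Lemma rec_cst k c : rec_in k (fun _ => c).
Proof. by elim: c => [|c /Rec1_succ//]; exact: rec_zero. Qed.

Lemma rec_iteri k n x (step : nat -> nat -> seq nat -> nat) :
  rec_in k n -> rec_in k x ->
  rec_in k.+2 (fun w => step (nth 0 w 0) (nth 0 (behead w) 0) (behead (behead w))) ->
  rec_in k (fun v => iteri (n v) (fun i y => step i y v) (x v)).
Proof.
move=> rn rx rs.
pose f w := iteri (nth 0 w 0) (fun i y => step i y (behead w)) (x (behead w)).
have rf : rec_in k.+1 f by apply: (rec_prim rx rs).
(* The number of rounds becomes an extra first variable, the recursion argument of [f]. *)
apply: (@rec_in_ext k (fun v => f (mkseq (fun i => if i is j.+1 then nth 0 v j else n v) k.+1))).
  move=> v vk; rewrite /f /= /mkseq /=.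
  suff -> : [seq match i with 0 => n v | j.+1 => nth 0 v j end | i <- iota 1 k] = v by [].
  by rewrite (iotaDl 1 0) -map_comp -[RHS](mkseq_nth 0) vk.
apply: (rec_in_comp (h := fun i v => if i is j.+1 then nth 0 v j else n v)) rf _.
by case=> // j; rewrite ltnS => jk; apply: (@rec_var 0); rewrite addn0.
Qed.

Ltac rec_var_tac :=
  first [ by apply: (@rec_var 0) | by apply: (@rec_var 1) | by apply: (@rec_var 2)
        | by apply: (@rec_var 3) | by apply: (@rec_var 4) | by apply: (@rec_var 5)
        | by apply: (@rec_var 6)].

Lemma Rec2_add : Rec2 addn.
Proof.
apply: Rec2I; apply: (@rec_in_ext _ (fun v =>
  iteri (nth 0 v 0) (fun _ y => y.+1) (nth 0 v 1))) => [v _|].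
  by elim: (nth 0 v 0) => //= n ->.
by apply: (rec_iteri (step := fun _ y _ => y.+1)); [..|apply: Rec1_succ]; rec_var_tac.
Qed.

Lemma Rec2_mul : Rec2 muln.
Proof.
apply: Rec2I; apply: (@rec_in_ext _ (fun v =>
  iteri (nth 0 v 0) (fun _ y => nth 0 v 1 + y) 0)) => [v _|].
  by elim: (nth 0 v 0) => //= n ->; rewrite mulSn.
apply: (rec_iteri (step := fun _ y v => nth 0 v 1 + y)); [rec_var_tac|exact: rec_cst|].
by apply: Rec2_add; rec_var_tac.
Qed.

Lemma Rec2_exp : Rec2 expn.
Proof.
apply: Rec2I; apply: (@rec_in_ext _ (fun v =>
  iteri (nth 0 v 1) (fun _ y => nth 0 v 0 * y) 1)) => [v _|].
  by elim: (nth 0 v 1) => //= n ->; rewrite expnS.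
apply: (rec_iteri (step := fun _ y v => nth 0 v 0 * y)); [rec_var_tac|exact: rec_cst|].
by apply: Rec2_mul; rec_var_tac.
Qed.

Lemma Rec1_pred : Rec1 predn.
Proof.
apply: Rec1I; apply: (@rec_in_ext _ (fun v =>
  iteri (nth 0 v 0) (fun i _ => i) 0)) => [v _|].
  by case: (nth 0 v 0).
by apply: (rec_iteri (step := fun i _ _ => i)); [rec_var_tac|exact: rec_cst|rec_var_tac].
Qed.

Lemma Rec2_sub : Rec2 subn.
Proof.
apply: Rec2I; apply: (@rec_in_ext _ (fun v =>
  iteri (nth 0 v 1) (fun _ y => y.-1) (nth 0 v 0))) => [v _|].
  by elim: (nth 0 v 1) => //= [|n ->]; rewrite ?subn0 ?subnS.
by apply: (rec_iteri (step := fun _ y _ => y.-1)); [..|apply: Rec1_pred]; rec_var_tac.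
Qed.

Lemma Rec2_leq : Rec2 (fun m n => m <= n).
Proof.
move=> k f g rf rg; apply: (@rec_in_ext _ (fun v => 1 - (f v - g v))).
  by move=> v _; rewrite /leq; case: (f v - g v).
by apply: Rec2_sub; [exact: rec_cst|exact: Rec2_sub].
Qed.

Lemma Rec2_eq : Rec2 (fun m n => m == n).
Proof.
move=> k f g rf rg; apply: (@rec_in_ext _ (fun v => (f v <= g v) * (g v <= f v))).
  by move=> v _; rewrite eqn_leq mulnb.
by apply: Rec2_mul; apply: Rec2_leq.
Qed.

Lemma rec_negb k (b : seq nat -> bool) :
  rec_in k (fun v => b v) -> rec_in k (fun v => ~~ b v).
Proof.
move=> rb; apply: (@rec_in_ext _ (fun v => 1 - b v)); first by move=> v _; case: (b v).
by apply: Rec2_sub; [exact: rec_cst|].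
Qed.

Lemma rec_andb k (b c : seq nat -> bool) :
  rec_in k (fun v => b v) -> rec_in k (fun v => c v) ->
  rec_in k (fun v => b v && c v).
Proof.
move=> rb rc; apply: (@rec_in_ext _ (fun v => b v * c v)).
  by move=> v _; rewrite mulnb.
exact: Rec2_mul.
Qed.

Lemma rec_if k (b : seq nat -> bool) f g :
  rec_in k (fun v => b v) -> rec_in k f -> rec_in k g ->
  rec_in k (fun v => if b v then f v else g v).
Proof.
move=> rb rf rg; apply: (@rec_in_ext _ (fun v => b v * f v + (1 - b v) * g v)).
  by move=> v _; case: (b v); rewrite ?mul1n ?mul0n ?addn0 ?add0n.
by apply: Rec2_add; apply: Rec2_mul => //; apply: Rec2_sub => //; apply: rec_cst.
Qed.

(** The dropped second variable is the accumulator that [rec_iteri] inserts below the counter and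
    that the summands do not see. *)
Lemma rec_skip k (F : nat -> seq nat -> nat) :
  rec_in k.+1 (fun w => F (nth 0 w 0) (behead w)) ->
  rec_in k.+2 (fun w => F (nth 0 w 0) (behead (behead w))).
Proof.
move=> rF.
apply: (@rec_in_ext _ (fun w => (fun u => F (nth 0 u 0) (behead u))
   (mkseq (fun i => if i is j.+1 then nth 0 w j.+2 else nth 0 w 0) k.+1))).
  move=> [|i [|y v]] //= [vk].
  by rewrite (iotaDl 1 0) -map_comp; congr F; rewrite -[RHS](mkseq_nth 0) vk.
apply: (rec_in_comp (h := fun i w => if i is j.+1 then nth 0 w j.+2 else nth 0 w 0)) rF _.
by case=> [_|j jk]; apply: (@rec_var 0); rewrite addn0.
Qed.

Lemma rec_count k n (P : nat -> seq nat -> bool) :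
  rec_in k n -> rec_in k.+1 (fun w => P (nth 0 w 0) (behead w)) ->
  rec_in k (fun v => count (P^~ v) (iota 0 (n v))).
Proof.
move=> rn rP; apply: (@rec_in_ext _ (fun v =>
  iteri (n v) (fun i y => y + P i v) 0)) => [v _|].
  by elim: (n v) => // m IHm; rewrite -[in RHS](addn1 m) iotaD count_cat /= addn0 IHm.
apply: (rec_iteri (step := fun i y v => y + P i v)) => //; first exact: rec_cst.
apply: Rec2_add; first rec_var_tac.
exact: (rec_skip (F := fun i v => P i v)).
Qed.

Lemma rec_has k n (P : nat -> seq nat -> bool) :
  rec_in k n -> rec_in k.+1 (fun w => P (nth 0 w 0) (behead w)) ->
  rec_in k (fun v => has (P^~ v) (iota 0 (n v))).
Proof.
move=> rn rP; apply: (@rec_in_ext _ (fun v =>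
  1 <= count (P^~ v) (iota 0 (n v)))) => [v _|]; first by rewrite has_count.
by apply: Rec2_leq; [exact: rec_cst|exact: rec_count].
Qed.

(** A bounded search returns the number of [i < n v] with no witness up to [i]; this is right for
    failing searches too. *)
Lemma rec_find k n (P : nat -> seq nat -> bool) :
  rec_in k n -> rec_in k.+1 (fun w => P (nth 0 w 0) (behead w)) ->
  rec_in k (fun v => find (P^~ v) (iota 0 (n v))).
Proof.
move=> rn rP; apply: (@rec_in_ext _ (fun v =>
  count (fun i => ~~ has (P^~ v) (iota 0 i.+1)) (iota 0 (n v)))) => [v _|].
  pose Q i := ~~ has (P^~ v) (iota 0 i.+1); rewrite -/Q.
  elim: (n v) => // m IHm; rewrite -(addn1 m) !iotaD count_cat find_cat IHm.
  rewrite size_iota /= addn0 add0n /Q -[m.+1]addn1 iotaD has_cat /= orbF add0n.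
  case: (boolP (has _ _)) => /= [_|Pm]; first by rewrite addn0.
  by rewrite hasNfind // size_iota; case: (P m v).
apply: (rec_count (P := fun i v => ~~ has (P^~ v) (iota 0 i.+1))) => //.
apply: rec_negb; apply: (rec_has (n := fun w => (nth 0 w 0).+1) (P := fun i w => P i (behead w))).
  by apply: Rec1_succ; rec_var_tac.
exact: (rec_skip (F := fun i v => P i v)).
Qed.

(** A hook of [rec_tac], redefined once the decoding functions are known to be recursive. *)
Ltac rec_user := fail.
Ltac rec_step := cbv beta; first [ assumption | lazymatch goal with
  | |- rec_in _ (fun _ => ?c) => exact: rec_cst
  | |- rec_in _ (fun v => nth 0 _ _) => rec_var_tac
  | |- rec_in _ (fun v => (@?f v).+1) => apply: (@Rec1_succ _ f)
  | |- rec_in _ (fun v => (@?f v).-1) => apply: (@Rec1_pred _ f)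
  | |- rec_in _ (fun v => @?f v + @?g v) => apply: (@Rec2_add _ f g)
  | |- rec_in _ (fun v => @?f v * @?g v) => apply: (@Rec2_mul _ f g)
  | |- rec_in _ (fun v => @?f v ^ @?g v) => apply: (@Rec2_exp _ f g)
  | |- rec_in _ (fun v => @?f v - @?g v) => apply: (@Rec2_sub _ f g)
  | |- rec_in _ (fun v => nat_of_bool (@?f v <= @?g v)) => apply: (@Rec2_leq _ f g)
  | |- rec_in _ (fun v => nat_of_bool (@?f v == @?g v)) => apply: (@Rec2_eq _ f g)
  | |- rec_in _ (fun v => nat_of_bool (~~ _)) => apply: rec_negb
  | |- rec_in _ (fun v => nat_of_bool (_ && _)) => apply: rec_andb
  | |- rec_in _ (fun v => nat_of_bool (has _ _)) => apply: rec_has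
  | |- rec_in _ (fun v => count _ _) => apply: rec_count
  | |- rec_in _ (fun v => find _ _) => apply: rec_find
  | |- rec_in _ (fun v => if _ then _ else _) => apply: rec_if
  | |- _ => rec_user end ].
Ltac rec_tac := repeat rec_step.

Lemma find_iotaE (p : pred nat) n u :
  u < n -> p u -> (forall i, i < u -> ~~ p i) -> find p (iota 0 n) = u.
Proof.
move=> un pu pN; rewrite -(subnKC (ltnW un)) iotaD find_cat size_iota add0n.
have -> : has p (iota 0 u) = false.
  by apply/hasPn => i; rewrite mem_iota /= add0n => /pN.
by have [k ->] : exists k, n - u = k.+1 by [exists (n - u).-1; lia];
   rewrite /= pu addn0.
Qed.

(** * The coding of pairs and sequences *)

(** [2 ^ h * t.*2.+1] codes the sequence with head [h] whose tail has code [t], so injectivity comes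
    from [CodeSeq]. *)
Lemma code_cons_inj h t h' t' :
  2 ^ h * t.*2.+1 = 2 ^ h' * t'.*2.+1 -> h = h' /\ t = t'.
Proof.
rewrite -{1}(CodeSeq.decodeK t) -{1}(CodeSeq.decodeK t').
move/(can_inj CodeSeq.codeK (x1 := h :: _) (x2 := h' :: _)) => [-> tt'].
by split => //; exact: (can_inj CodeSeq.decodeK).
Qed.

Definition headc c := head 0 (CodeSeq.decode c).
Definition tailc c := CodeSeq.code (behead (CodeSeq.decode c)).

Lemma headcE h t : headc (2 ^ h * t.*2.+1) = h.
Proof.
by rewrite /headc -{1}(CodeSeq.decodeK t) (CodeSeq.codeK (h :: CodeSeq.decode t)).
Qed.

Lemma tailcE h t : tailc (2 ^ h * t.*2.+1) = t.
Proof.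
by rewrite /tailc -{1}(CodeSeq.decodeK t)
  (CodeSeq.codeK (h :: CodeSeq.decode t)) /= CodeSeq.decodeK.
Qed.

Lemma headc_exp x : headc (2 ^ x) = x.
Proof. by rewrite -[2 ^ x]muln1 -[1]/(0.*2.+1) headcE. Qed.

Lemma code_gt h t : h < 2 ^ h * t.*2.+1 /\ t < 2 ^ h * t.*2.+1.
Proof. by have := ltn_expl h (isT : 1 < 2); split; nia. Qed.

Lemma code_split c : c = 0 \/ c = 2 ^ headc c * (tailc c).*2.+1.
Proof.
rewrite /tailc /headc -{1 2}(CodeSeq.decodeK c).
by case: (CodeSeq.decode c) => [|h s]; [left|right].
Qed.

(** Head and tail code are both smaller than a nonzero code, which bounds the search. For the code 0
    the search range is empty and yields the default 0. *)
Lemma Rec1_headc : Rec1 headc.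
Proof.
apply: Rec1I; apply: (@rec_in_ext _ (fun v => find (fun h =>
  has (fun t => 2 ^ h * (t + t).+1 == nth 0 v 0) (iota 0 (nth 0 v 0)))
  (iota 0 (nth 0 v 0)))) => [v _|]; last by rec_tac.
have [->//|] := code_split (nth 0 v 0).
set c := nth 0 v 0; move: (headc c) (tailc c) => h t ->.
have [hc tc] := code_gt h t.
apply: find_iotaE => //.
  by apply/hasP; exists t; rewrite ?mem_iota //= addnn.
move=> i ih; apply/hasPn => u _; rewrite addnn.
by apply/eqP => /code_cons_inj[ihE]; rewrite ihE ltnn in ih.
Qed.

Lemma Rec1_tailc : Rec1 tailc.
Proof.
apply: Rec1I; apply: (@rec_in_ext _ (fun v => find (fun t =>
  has (fun h => 2 ^ h * (t + t).+1 == nth 0 v 0) (iota 0 (nth 0 v 0)))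
  (iota 0 (nth 0 v 0)))) => [v _|]; last by rec_tac.
have [->//|] := code_split (nth 0 v 0).
set c := nth 0 v 0; move: (headc c) (tailc c) => h t ->.
have [hc tc] := code_gt h t.
apply: find_iotaE => //.
  by apply/hasP; exists h; rewrite ?mem_iota //= addnn.
move=> i it; apply/hasPn => u _; rewrite addnn.
by apply/eqP => /code_cons_inj[_ itE]; rewrite itE ltnn in it.
Qed.

Definition nthc c i := headc (iter i tailc c).

Lemma nthcE s i : nthc (CodeSeq.code s) i = nth 0 s i.
Proof.
rewrite /nthc; elim: s i => [|x s IHs] i.
  by rewrite nth_nil; suff -> : iter i tailc (CodeSeq.code [::]) = 0 by []; elim: i => //= i ->.
by case: i => [|i]; rewrite ?iterSr /= ?headcE ?tailcE.
Qed.

Lemma Rec2_nthc : Rec2 nthc.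
Proof.
apply: Rec2I; apply: Rec1_headc.
apply: (@rec_in_ext _ (fun v => iteri (nth 0 v 1) (fun _ => tailc) (nth 0 v 0))) => [v _|].
  by elim: (nth 0 v 1) => //= i ->.
by apply: (rec_iteri (step := fun _ y _ => tailc y)); [..|apply: Rec1_tailc]; rec_tac.
Qed.

Ltac rec_user ::= first
  [ apply: Rec1_headc | apply: Rec1_tailc | apply: Rec2_nthc ].

Lemma rec_weak k f : rec_in k f -> rec_in k.+1 (fun w => f (behead w)).
Proof.
move=> rf; apply: (@rec_in_ext _ (fun w => f (mkseq (fun i => nth 0 w i.+1) k))).
  by move=> [|x v] //= [vk]; rewrite -[in RHS](mkseq_nth 0 v) vk.
by apply: (rec_in_comp (h := fun i w => nth 0 w i.+1)) rf _ => i ik;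
  apply: (@rec_var 0); rewrite addn0.
Qed.

Lemma rec_subst k f (F : nat -> seq nat -> nat) :
  rec_in k f -> rec_in k.+1 (fun w => F (nth 0 w 0) (behead w)) ->
  rec_in k (fun v => F (f v) v).
Proof.
move=> rf rF; apply: (@rec_in_ext _ (fun v => (fun w => F (nth 0 w 0) (behead w))
   (mkseq (fun i => if i is j.+1 then nth 0 v j else f v) k.+1))).
  by move=> v vk /=; rewrite (iotaDl 1 0) -map_comp; congr F; rewrite -[RHS](mkseq_nth 0) vk.
apply: (rec_in_comp (h := fun i v => if i is j.+1 then nth 0 v j else f v)) rF _.
by case=> [_|j jk] //; apply: (@rec_var 0); rewrite addn0.
Qed.

(* The code of a sequence is computed from its end. *)
Lemma rec_mkseq k n (F : nat -> seq nat -> nat) :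
  rec_in k n -> rec_in k.+1 (fun w => F (nth 0 w 0) (behead w)) ->
  rec_in k (fun v => CodeSeq.code (mkseq (F^~ v) (n v))).
Proof.
move=> rn rF; apply: (@rec_in_ext _ (fun v => iteri (n v)
  (fun i y => 2 ^ F (n v - i.+1) v * (y + y).+1) 0)) => [v _|].
  suff H m : m <= n v -> iteri m (fun i y => 2 ^ F (n v - i.+1) v * (y + y).+1) 0 =
      CodeSeq.code [seq F i v | i <- iota (n v - m) m].
    by rewrite H // subnn.
  elim: m => // m IHm mn; rewrite /= {}IHm 1?ltnW // addnn.
  by rewrite -[n v - m]prednK ?subn_gt0 // subnS.
apply: (rec_iteri (step := fun i y v => 2 ^ F (n v - i.+1) v * (y + y).+1)) => //.
  exact: rec_cst.
have rn2 : rec_in k.+2 (fun w => n (behead (behead w))) :=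
  rec_weak (rec_weak rn).
rec_tac; apply: (rec_subst (F := fun i w => F i (behead (behead w)))); first by rec_tac.
by apply: (rec_skip (F := fun i w => F i (behead w))); apply: rec_skip.
Qed.

Lemma rec_sum k n (F : nat -> seq nat -> nat) :
  rec_in k n -> rec_in k.+1 (fun w => F (nth 0 w 0) (behead w)) ->
  rec_in k (fun v => \sum_(i < n v) F i v).
Proof.
move=> rn rF; apply: (@rec_in_ext _ (fun v =>
  iteri (n v) (fun i y => y + F i v) 0)) => [v _|].
  by elim: (n v) => [|m IHm]; rewrite ?big_ord0 // big_ord_recr /= IHm.
apply: (rec_iteri (step := fun i y v => y + F i v)) => //; first exact: rec_cst.
by apply: Rec2_add; [rec_tac|apply: rec_skip].
Qed.

Lemma Rec1_mu (P : nat -> nat -> bool) (f : nat -> nat) :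
  rec_in 2 (fun v => P (nth 0 v 0) (nth 0 v 1)) ->
  (forall x, P (f x) x) -> (forall x n, n < f x -> ~~ P n x) -> Rec1 f.
Proof.
move=> rP Pf Pmin; apply: Rec1I.
apply: (@rec_mu _ (fun v => ~~ P (nth 0 v 0) (nth 0 v 1))).
- exact: (rec_negb (b := fun v => P (nth 0 v 0) (nth 0 v 1))).
- by move=> v /=; rewrite Pf.
- by move=> v n /= /Pmin ->.
Qed.

Lemma computableE (A B : countType) (f : A -> B) : computable f <->
  exists2 g, Rec1 g & forall x, pickle (f x) = g (pickle x).
Proof.
have E g : (fun v : 1.-tuple nat => g (thead v)) = (fun v => g (nth 0 v 0)).
  by apply: funext => v; rewrite /thead (tnth_nth 0).
split=> [[g [rg fg]]|[g rg fg]]; exists g => //.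
  by apply: Rec1I; rewrite /rec_in -E.
by split=> //; rewrite E; exact: (rg 1 _ (@rec_var 0 1 0 isT)).
Qed.

Lemma computable_nat (f : nat -> nat) : computable f <-> Rec1 f.
Proof.
split; first by move=> /computableE[g rg fg]; have -> : f = g by apply: funext.
by move=> rf; apply/computableE; exists f.
Qed.

Lemma pickle_pair (p : nat * nat) :
  pickle p = 2 ^ p.1 * (2 ^ p.2 + 2 ^ p.2).+1.
Proof.
case: p => x y; change (CodeSeq.code [:: x; y] = 2 ^ x * (2 ^ y + 2 ^ y).+1).
by rewrite /= muln1 addnn.
Qed.

(** * Recursively enumerable sets *)

(** A number is read as a pair together with a stage. Where the check fails, the fixed member [p0]
    is output instead, so the empty set needs a case of its own. *)
Lemma re_pairs (R : nat -> nat -> nat -> bool) :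
  Rec3 (fun x y s => R x y s) ->
  re [set p : nat * nat | exists s, R p.1 p.2 s].
Proof.
move=> rR; have [[p0 [s0 R0]]|R0] := pselect (exists p : nat * nat, exists s, R p.1 p.2 s);
  last first.
  by left; apply/seteqP; split=> // p Rp; apply: R0; exists p.
right; pose b n := R (headc n) (headc (tailc n)) (tailc (tailc n)).
exists (fun n => if b n then (headc n, headc (tailc n)) else p0).
  apply/computableE; exists (fun n => if b n then
     2 ^ headc n * (2 ^ headc (tailc n) + 2 ^ headc (tailc n)).+1 else pickle p0).
    apply: Rec1I; apply: rec_if; [|by rec_tac..].
    apply: (rR _ (fun v => headc (nth 0 v 0)) (fun v => headc (tailc (nth 0 v 0)))
      (fun v => tailc (tailc (nth 0 v 0)))); rec_tac.
  by move=> n; rewrite -[pickle n]/n; case: (b n); rewrite ?pickle_pair.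
apply/seteqP; split=> [_ [n _ <-]|[e x] [s Rs]] /=.
  by case: ifP => [bn|_]; [exists (tailc (tailc n))|exists s0].
exists (2 ^ e * (2 ^ x * s.*2.+1).*2.+1) => //.
by rewrite /b !(headcE, tailcE) Rs.
Qed.

(** For nonempty [Z], [r x s] says that [x] is among the first [s] values of an enumeration. *)
Lemma re_stages (Z : set nat) : re Z -> exists r : nat -> nat -> bool,
  [/\ Rec2 (fun x s => r x s),
      forall x s t, s <= t -> r x s -> r x t &
      forall x, Z x <-> exists s, r x s].
Proof.
case=> [->|[f /computable_nat rf <-]].
  by exists (fun _ _ => false); split=> [k f g _ _|//|x]; [exact: rec_cst|split=> // -[]].
exists (fun x s => has (fun i => f i == x) (iota 0 s)); split.
- by apply: Rec2I; rec_tac; apply: rf; rec_tac.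
- move=> x s t st /hasP[i]; rewrite mem_iota => /= si fi.
  by apply/hasP; exists i => //; rewrite mem_iota /=; lia.
- move=> x; split=> [[i _ <-]|[s /hasP[i _ /eqP]]]; last by exists i.
  by exists i.+1; apply/hasP; exists i => //; rewrite mem_iota /=.
Qed.

(** * Counting class boundaries *)

(* [P] is the set of boundaries, either the true one or its approximation at
   some stage.  [0] is not counted, so [cnt P y] is the index of the class of
   [y]. *)
Definition cnt (P : pred nat) y := count (fun z => P z.+1) (iota 0 y).

Lemma cntS P y : cnt P y.+1 = cnt P y + P y.+1.
Proof. by rewrite /cnt -[in LHS]addn1 iotaD count_cat /= addn0 add0n. Qed.

Lemma leq_cnt P x y : x <= y -> cnt P x <= cnt P y.
Proof.
by move/subnKC <-; rewrite /cnt iotaD count_cat leq_addr.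
Qed.

(** More boundaries give at least as many of them between [x] and [y]; the additive form avoids
    truncated subtraction. *)
Lemma cnt_sub (P Q : pred nat) x y : (forall z, P z -> Q z) -> x <= y ->
  cnt P y + cnt Q x <= cnt P x + cnt Q y.
Proof.
move=> PQ; elim: y => [|y IHy]; first by rewrite leqn0 => /eqP ->; rewrite addnC.
rewrite leq_eqVlt => /orP[/eqP->|]; first by rewrite addnC.
rewrite ltnS !cntS => /IHy; have := PQ y.+1.
by case: (P y.+1) => [/(_ isT) ->|_]; lia.
Qed.

Lemma eq_cnt (P Q : pred nat) y : (forall z, z <= y -> P z = Q z) ->
  cnt P y = cnt Q y.
Proof.
move=> PQ; apply: eq_in_count => z; rewrite mem_iota add0n => /andP[_ zy].
exact: PQ.
Qed.

Definition start P e := find (fun x => cnt P x == cnt P e) (iota 0 e.+1).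

Lemma startP P e :
  [/\ start P e <= e, cnt P (start P e) = cnt P e &
      forall x, cnt P x = cnt P e -> start P e <= x].
Proof.
have hase : has (fun x => cnt P x == cnt P e) (iota 0 e.+1).
  by apply/hasP; exists e; rewrite ?mem_iota /=.
have lte : start P e < e.+1.
  by rewrite /start -[ltnRHS](size_iota 0) -has_find.
split=> //.
  by have := nth_find 0 hase; rewrite nth_iota // => /eqP.
move=> x xe; rewrite leqNgt; apply/negP => xs.
have := before_find 0 xs; rewrite nth_iota ?add0n ?xe ?eqxx //.
exact: ltn_trans xs lte.
Qed.

(** Class indices from [cnt P e] to [cnt P e + (e - start P e)], again without subtraction. *)
Definition member P e y :=
  (cnt P e <= cnt P y) && (cnt P y + start P e <= cnt P e + e).

(** Passing from [Q] to the smaller [P] moves the start of the class of [e] to the left, which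
    allows more classes, while the number of classes between [e] and [y] can only drop. *)
Lemma member_sub (P Q : pred nat) e y : (forall z, P z -> Q z) ->
  member Q e y -> member P e y.
Proof.
move=> PQ /andP[ey ye].
have [leP eP minP] := startP P e; have [leQ eQ minQ] := startP Q e.
have sPQ : start P e <= start Q e.
  apply: minP; have := leq_cnt P leQ; have := cnt_sub PQ leQ; lia.
apply/andP; have [ley|/ltnW lye] := leqP e y.
  by have := leq_cnt P ley; have := cnt_sub PQ ley; split; lia.
have := leq_cnt P lye; have := leq_cnt Q lye; have := cnt_sub PQ lye; split; lia.
Qed.

Lemma eq_start (P Q : pred nat) e : (forall z, z <= e -> P z = Q z) ->
  start P e = start Q e.
Proof.
move=> PQ; apply: eq_in_find => x; rewrite mem_iota => /= xe.
by rewrite !(eq_cnt (Q := Q)) // => z zx; apply: PQ; lia.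
Qed.

Lemma eq_member (P Q : pred nat) e y : (forall z, z <= maxn e y -> P z = Q z) ->
  member P e y = member Q e y.
Proof.
move=> PQ; rewrite /member (eq_start (Q := Q)) => [|z ze]; last by apply: PQ; lia.
by rewrite !(eq_cnt (Q := Q)) // => z ze; apply: PQ; lia.
Qed.

(** If some [e] in the class of [m] has an associated set ending in the class of [x], then [e] is
    this number. *)
Definition bound P m x := start P m + (cnt P x - cnt P m).

(* For [m] the least and [x] the largest datum: the largest element of the class
   of [m] whose associated set does not reach beyond the class of [x]. *)
Definition guess P m x := bound P m x -
  find (fun d => cnt P (bound P m x - d) == cnt P m) (iota 0 (bound P m x).+1).

Lemma guessE P m x u : u <= bound P m x -> cnt P u = cnt P m ->
  (forall i, u < i <= bound P m x -> cnt P i <> cnt P m) -> guess P m x = u.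
Proof.
move=> uB um iN; rewrite /guess (@find_iotaE _ _ (bound P m x - u)); first lia.
- lia.
- by rewrite subKn // um.
- by move=> i iB; apply/eqP/iN; lia.
Qed.

(** The search stays below [bound P m x], which is at most [m + x] because [start P m <= m] and
    [cnt P x <= x]. *)
Lemma eq_guess (P Q : pred nat) m x : (forall z, z <= m + x -> P z = Q z) ->
  guess P m x = guess Q m x.
Proof.
move=> PQ; have cPQ z : z <= m + x -> cnt P z = cnt Q z.
  by move=> zmx; apply: eq_cnt => y yz; apply: PQ; lia.
have sPQ : start P m = start Q m by apply: eq_start => z zm; apply: PQ; lia.
have bPQ : bound P m x = bound Q m x by rewrite /bound sPQ !cPQ //; lia.
have bP : bound P m x <= m + x.
  have [sm _ _] := startP P m; rewrite /bound.
  have : cnt P x <= x by rewrite /cnt -[leqRHS](size_iota 0) count_size.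
  lia.
rewrite /guess -bPQ; congr (_ - _); apply: eq_find => d.
by rewrite !cPQ //; lia.
Qed.

(** Here [bound P m x] is [e] itself, which lies in the class of [m], so the downward search stops
    at once. *)
Lemma guess_member P e m x :
  cnt P m = cnt P e -> cnt P x = cnt P e + (e - start P e) -> guess P m x = e.
Proof.
move=> me xe; have [se cse mine] := startP P e; have [sm csm minm] := startP P m.
have smE : start P m = start P e.
  by apply/eqP; rewrite eqn_leq minm ?mine // ?csm ?cse.
have bE : bound P m x = e by rewrite /bound smE; lia.
by apply: guessE; rewrite ?bE // => i; lia.
Qed.

Lemma infinite_range_inj T (f : nat -> T) (X : set T) :
  injective f -> (forall n, X (f n)) -> infinite_set X.
Proof.
move=> finj fX Xfin; apply: infinite_nat.
have -> : [set: nat] = f @^-1` X by apply/seteqP; split=> n //= _; exact: fX.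
by apply: finite_preimage => // x y _ _; exact: finj.
Qed.

(** * Classes between consecutive boundaries and their unions *)

Section Intervals.
Variables (Z : set nat) (a : nat -> nat).
Hypotheses (ha : ascending_enumeration a (~` Z)) (Z0 : ~ Z 0).

Definition compl : pred nat := fun z => `[< ~ Z z >].

Let a_lt m n : m < n -> a m < a n. Proof. by have [am _] := ha; exact: am. Qed.

Let a_leq : {mono a : m n / m <= n}. Proof. exact: leq_mono a_lt. Qed.

Let a_notin n : ~ Z (a n).
Proof. by have [_ aZ] := ha; have : (~` Z) (a n) by rewrite -aZ; exists n. Qed.

Let a_surj x : ~ Z x -> exists n, a n = x.
Proof. by have [_ aZ] := ha; rewrite -[~ Z x]/((~` Z) x) -aZ => -[n _ <-]; exists n. Qed.

(** Induction on [y]. The base case needs [a 0 = 0], which follows from [Z0] and fits the convention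
    that [cnt] omits 0. A boundary at [y.+1] can only be the next value of [a]. *)
Lemma cntP y : a (cnt compl y) <= y < a (cnt compl y).+1.
Proof.
elim: y => [|y /andP[IH1 IH2]].
  have [n an] := a_surj Z0; have : a 0 <= a n by rewrite a_leq.
  by rewrite an leqn0 => /eqP a00; have := a_lt (ltnSn 0); rewrite /cnt /= a00.
rewrite cntS /compl; case: asboolP => [yZ|/contrapT yZ] /=; last first.
  rewrite addn0 (leqW IH1) ltn_neqAle IH2 andbT.
  by apply/eqP => yE; apply: (a_notin (n := (cnt compl y).+1)); rewrite -yE.
have [n an] := a_surj yZ; rewrite addn1; set k := cnt _ _ in IH1 IH2 *.
have kn : k < n by rewrite -(leqW_mono a_leq) an; lia.
have nk : n <= k.+1 by rewrite -a_leq an; lia.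
have -> : k.+1 = n by lia.
by rewrite an leqnn -an a_lt.
Qed.

(** A Galois connection: comparisons with boundaries turn into comparisons of class indices, which
    are left to linear arithmetic. *)
Lemma leq_a_cnt n y : (a n <= y) = (n <= cnt compl y).
Proof.
have /andP[ay ya] := cntP y; apply/idP/idP => [any|ny]; last first.
  by apply: leq_trans ay; rewrite a_leq.
by rewrite -ltnS -(leqW_mono a_leq) (leq_ltn_trans any).
Qed.

Lemma cnt_a n : cnt compl (a n) = n.
Proof.
apply/eqP; rewrite eqn_leq -leq_a_cnt leqnn andbT.
by rewrite -a_leq leq_a_cnt.
Qed.

Lemma start_a e : start compl e = a (cnt compl e).
Proof.
have [se cse mine] := startP compl e; apply/eqP; rewrite eqn_leq.
by rewrite mine ?cnt_a // leq_a_cnt cse leqnn.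
Qed.

Section Equivalence.
Variable zeta : nat -> nat -> Prop.
Hypothesis hzeta : forall x y, zeta x y <->
  exists n, a n <= minn x y /\ minn x y <= maxn x y /\ maxn x y < a n.+1.

Lemma zetaE x y : zeta x y <-> cnt compl x = cnt compl y.
Proof.
rewrite hzeta; split=> [[n [nm [_ mn]]]|xy].
  suff E z : minn x y <= z <= maxn x y -> cnt compl z = n by rewrite !E //; lia.
  move=> /andP[mz zm]; have : n <= cnt compl z by rewrite -leq_a_cnt; lia.
  by have : ~~ (n.+1 <= cnt compl z) by [rewrite -leq_a_cnt; lia]; lia.
have := cntP x; have := cntP y; rewrite -xy => yc xc.
by exists (cnt compl x); lia.
Qed.

Lemma zeta_equivalence : Equivalence zeta.
Proof.
by split=> [x|x y|x y z]; rewrite !zetaE // => -> ->.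
Qed.

Lemma infinite_eq_classes : infinite_set (eq_classes zeta).
Proof.
apply: (@infinite_range_inj _ (fun n => [set y | zeta (a n) y])) => [m n mn|n].
  have : [set y | zeta (a m) y] (a n) by rewrite mn /=; apply/zetaE.
  by rewrite /= zetaE !cnt_a.
by exists (a n).
Qed.

Lemma zeta_closedE L : zeta_closed zeta L <->
  forall x y, cnt compl x = cnt compl y -> L x -> L y.
Proof.
split=> [[F FC ->] x y xy [C FCx Cx]|Lcl].
  exists C => //; have [z Cz] := FC _ FCx; move: Cx; rewrite Cz /= !zetaE.
  by rewrite xy.
exists [set C | exists2 x, L x & C = [set y | zeta x y]].
  by move=> C [x _ ->]; exists x.
apply/seteqP; split=> [x Lx|y [_ [x Lx ->]]] /=.
  by exists [set y | zeta x y]; [exists x|apply/zetaE].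
by rewrite zetaE => xy; exact: Lcl Lx.
Qed.

Lemma zeta_closure_id L : zeta_closed zeta L -> zeta_closure zeta L = L.
Proof.
move=> /zeta_closedE Lcl; apply/seteqP; split=> [y [x Lx]|x Lx].
  by rewrite zetaE => xy; exact: Lcl Lx.
by exists x => //; apply/zetaE.
Qed.

Definition interval e : set nat := [set y | member compl e y].

Lemma interval_closed e : zeta_closed zeta (interval e).
Proof. by apply/zeta_closedE => x y xy; rewrite /interval /= /member xy. Qed.

End Equivalence.

Lemma interval_inj : injective interval.
Proof.
suff H e d : e < d -> interval e <> interval d.
  by move=> e d ed; have [lt|lt|//] := ltngtP e d; [case: (H _ _ lt)|case: (H _ _ lt)].
move=> ed I; have [se cse mine] := startP compl e; have [sd csd mind] := startP compl d.
(* Each set contains the start of its own first class, so equal sets begin with the same class. *)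
have cde : cnt compl d = cnt compl e.
  have Id : interval d (start compl d) by rewrite /interval /= /member; lia.
  have Ie : interval e (start compl e) by rewrite /interval /= /member; lia.
  by rewrite -I in Id; rewrite I in Ie; move: Id Ie; rewrite /interval /= /member; lia.
(* The start of the last class of [interval d] lies too far right for [interval e]. *)
have : interval d (a (cnt compl d + (d - start compl d))).
  by rewrite /interval /= /member cnt_a; lia.
rewrite -I /interval /= /member cnt_a.
have := start_a e; have := start_a d; rewrite cde; lia.
Qed.

End Intervals.

(** * The confident learner *)

(** What has not yet entered [Z] counts as a boundary, so the stages shrink towards [compl Z]. *)
Definition stage (r : nat -> nat -> bool) (s : nat) : pred nat :=
  fun z => ~~ r z s.

Section RecStage.
Variable r : nat -> nat -> bool.
Hypothesis rr : Rec2 (fun x s => r x s).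

Lemma Rec2_cnt : Rec2 (fun s y => cnt (stage r s) y).
Proof.
apply: Rec2I; rewrite /cnt /stage; rec_tac.
by apply: (rr (f := fun w => (nth 0 w 0).+1)); rec_tac.
Qed.

Lemma Rec2_start : Rec2 (fun s e => start (stage r s) e).
Proof.
by apply: Rec2I; rewrite /start; rec_tac; apply: Rec2_cnt; rec_tac.
Qed.

Lemma rec_guess k s m x : rec_in k s -> rec_in k m -> rec_in k x ->
  rec_in k (fun v => guess (stage r (s v)) (m v) (x v)).
Proof.
move=> rs rm rx; pose b v := bound (stage r (s v)) (m v) (x v).
have rb : rec_in k b.
  rewrite /b /bound; apply: Rec2_add; first exact: Rec2_start.
  by apply: Rec2_sub; apply: Rec2_cnt.
rewrite /guess; apply: Rec2_sub => //.
apply: rec_find; first exact: Rec1_succ.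
apply: Rec2_eq.
  apply: (Rec2_cnt (f := fun w => s (behead w))); first exact: rec_weak.
  apply: Rec2_sub; [exact: (rec_weak (f := b))|by rec_tac].
by apply: (Rec2_cnt (f := fun w => s (behead w)) (g := fun w => m (behead w)));
  apply: rec_weak.
Qed.

End RecStage.

(** * Data of a text segment read off its code *)

Definition occurs x c := has (fun i => nthc c i == 2 ^ x) (iota 0 c).
(** Without data the search fails and returns [c]. Since data are smaller than the code,
    [mindata c < c] tests whether there are any. *)
Definition mindata c := find (fun x => occurs x c) (iota 0 c).
Definition maxdata c := c - find (fun d => occurs (c - d) c) (iota 0 c.+1).

Lemma rec_occurs k x c : rec_in k x -> rec_in k c ->
  rec_in k (fun v => occurs (x v) (c v)).
Proof.
move=> rx rc; rewrite /occurs; apply: rec_has => //; apply: Rec2_eq.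
  by apply: (Rec2_nthc (f := fun w => c (behead w))); [exact: rec_weak|rec_tac].
by apply: (Rec2_exp (g := fun w => x (behead w))); [rec_tac|exact: rec_weak].
Qed.

Lemma Rec1_mindata : Rec1 mindata.
Proof. by apply: Rec1I; rewrite /mindata; rec_tac; apply: rec_occurs; rec_tac. Qed.

Lemma Rec1_maxdata : Rec1 maxdata.
Proof. by apply: Rec1I; rewrite /maxdata; rec_tac; apply: rec_occurs; rec_tac. Qed.

Lemma size_code s : size s <= CodeSeq.code s.
Proof.
by elim: s => //= x s IHs; have := expn_gt0 2 x; nia.
Qed.

(** [x < 2 ^ x], and the entry [2 ^ x] is below the code. Codes thus bound data, both in the
    searches of the learner and in the later comparison with [a]. *)
Lemma mem_pickle_seq (s : seq (option nat)) x :
  Some x \in s -> x < pickle s.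
Proof.
move=> xs; have /allP := CodeSeq.ltn_code (map pickle s).
move=> /(_ (pickle (Some x)) (map_f pickle xs)).
have -> : pickle (Some x) = 2 ^ x by rewrite -[RHS]muln1.
by apply: ltn_trans; exact: ltn_expl.
Qed.

(** Looking beyond the end of the sequence is harmless: the entries decoded there are 0, and
    [Some x] has the nonzero code [2 ^ x]. *)
Lemma occursE (s : seq (option nat)) x : occurs x (pickle s) = (Some x \in s).
Proof.
have px : pickle (Some x) = 2 ^ x by rewrite -[RHS]muln1.
rewrite -[pickle s]/(CodeSeq.code (map pickle s)); apply/hasP/idP => [[i _]|xs].
  rewrite nthcE => /eqP ix.
  have [si|si] := leqP (size s) i.
    by move: ix; rewrite nth_default ?size_map // => /eqP; rewrite eq_sym expn_eq0.
  rewrite (nth_map None) // -px in ix.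
  by rewrite -(pcan_inj pickleK ix) mem_nth.
exists (index (Some x) s); last by rewrite nthcE (nth_map None) ?index_mem // nth_index // px.
rewrite mem_iota /=; apply: leq_trans (size_code _).
by rewrite size_map index_mem.
Qed.

Lemma mindataE (s : seq (option nat)) m : Some m \in s ->
  (forall x, Some x \in s -> m <= x) -> mindata (pickle s) = m.
Proof.
move=> ms mmin; apply: find_iotaE; rewrite ?occursE ?mem_pickle_seq // => i im.
by rewrite occursE; apply/negP => /mmin; rewrite leqNgt im.
Qed.

Lemma mindata_none (s : seq (option nat)) :
  (forall x, Some x \notin s) -> mindata (pickle s) = pickle s.
Proof.
move=> sN; rewrite /mindata hasNfind ?size_iota //.
by apply/hasPn => x _; rewrite occursE.
Qed.

Lemma maxdataE (s : seq (option nat)) m : Some m \in s ->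
  (forall x, Some x \in s -> x <= m) -> maxdata (pickle s) = m.
Proof.
move=> ms mmax; have mc := mem_pickle_seq ms.
rewrite /maxdata (@find_iotaE _ _ (pickle s - m)); first lia.
- lia.
- by rewrite subKn 1?ltnW // occursE.
by move=> i im; rewrite occursE; apply/negP => /mmax; lia.
Qed.

Lemma leq_maxdata (s : seq (option nat)) x : Some x \in s -> x <= maxdata (pickle s).
Proof.
move=> xs; have [m ms mmax] : exists2 m, Some m \in s & forall y, Some y \in s -> y <= m.
  have ex : exists m, Some m \in s by exists x.
  have ub m : Some m \in s -> m <= pickle s by move/mem_pickle_seq/ltnW.
  by case: (ex_maxnP ex ub) => m ms mmax; exists m.
by rewrite (maxdataE ms mmax) mmax.
Qed.

Lemma initial_segmentP T n x :
  reflect (exists2 i, i < n & T i = Some x) (Some x \in initial_segment T n).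
Proof.
apply: (iffP mapP) => [[i]|[i ilt Ti]].
  by rewrite mem_iota => /= ilt Ti; exists i.
by exists i => //; rewrite mem_iota.
Qed.

Lemma initial_segment_cvg T L x : text_for T L -> L x ->
  exists n, forall j, n <= j -> Some x \in initial_segment T j.
Proof.
move=> <- [i Ti]; exists i.+1 => j ij; apply/initial_segmentP.
by exists i.
Qed.

Lemma initial_segment_sub T L x n : text_for T L ->
  Some x \in initial_segment T n -> L x.
Proof. by move=> <- /initial_segmentP[i _ Ti]; exists i. Qed.

(** Hence the code of a segment can serve as a stage that grows without bound along every text. *)
Lemma size_initial_segment T n : n <= pickle (initial_segment T n).
Proof.
by apply: leq_trans (size_code _); rewrite size_map size_mkseq.
Qed.

Section Learner.
Variables (Z : set nat) (a : nat -> nat) (r : nat -> nat -> bool).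
Hypotheses (ha : ascending_enumeration a (~` Z)) (Z0 : ~ Z 0).
Hypotheses (rr : Rec2 (fun x s => r x s))
  (r_mono : forall x s t, s <= t -> r x s -> r x t)
  (Zr : forall x, Z x <-> exists s, r x s).

Lemma compl_stage s z : compl Z z -> stage r s z.
Proof. by move=> /asboolP zZ; apply/negP => rz; apply: zZ; apply/Zr; exists s. Qed.

Lemma stage_cvg y : exists s0, forall s, s0 <= s ->
  forall z, z <= y -> stage r s z = compl Z z.
Proof.
have H z : exists s0, forall s, s0 <= s -> stage r s z = compl Z z.
  have [zZ|zZ] := pselect (Z z).
    have [s0 rz] := (Zr z).1 zZ; exists s0 => s ss; rewrite /stage (r_mono ss rz).
    by apply/esym/asboolP.
  exists 0 => s _; have cz : compl Z z by apply/asboolP.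
  by rewrite cz compl_stage.
elim: y => [|y [s0 IHy]].
  by have [s0 Hs] := H 0; exists s0 => s ss z; rewrite leqn0 => /eqP ->; exact: Hs.
have [s1 Hs] := H y.+1; exists (maxn s0 s1) => s ss z.
rewrite leq_eqVlt => /orP[/eqP ->|zy]; first by apply: Hs; lia.
by apply: IHy; lia.
Qed.

Lemma uniformly_re_interval : uniformly_re (interval Z).
Proof.
rewrite /uniformly_re.
have -> : [set p : nat * nat | interval Z p.1 p.2] =
          [set p | exists s, member (stage r s) p.1 p.2].
  apply/seteqP; split=> -[e y] /=; last by case=> s; apply/member_sub/compl_stage.
  have [s Hs] := stage_cvg (maxn e y).
  by exists s; rewrite (eq_member (Q := compl Z)) //; apply: Hs.
apply: (re_pairs (R := fun e y s => member (stage r s) e y)) =>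
  k f g h rf rg rh; rewrite /member; cbv beta.
apply: rec_andb.
  by apply: Rec2_leq; apply: Rec2_cnt.
by apply: Rec2_leq; apply: Rec2_add => //; (apply: Rec2_cnt || apply: Rec2_start).
Qed.

Definition learner_index (c : nat) := guess (stage r c) (mindata c) (maxdata c).

(** For bounded [L] both extreme data and the finitely many relevant boundaries settle. For
    unbounded [L] the guess settles on the last element of the class of the least datum. *)
Lemma learner_index_cvg T L x0 : text_for T L -> L x0 ->
  exists u n, (forall j, n <= j ->
    mindata (pickle (initial_segment T j)) < pickle (initial_segment T j) /\
    learner_index (pickle (initial_segment T j)) = u) /\
    forall e, L = interval Z e -> u = e.
Proof.
move=> TL Lx0; have [m [Lm mmin]] : exists m, L m /\ forall x, L x -> m <= x.
  have ex : exists m, `[< L m >] by exists x0; apply/asboolP.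
  case: (ex_minnP ex) => m /asboolP Lm mmin; exists m; split=> // x Lx.
  by apply: mmin; apply/asboolP.
have [n0 Hm] := initial_segment_cvg TL Lm.
have minE j : n0 <= j -> mindata (pickle (initial_segment T j)) = m.
  by move=> nj; apply: mindataE (Hm _ nj) _ => x /(initial_segment_sub TL)/mmin.
have minlt j : n0 <= j ->
    mindata (pickle (initial_segment T j)) < pickle (initial_segment T j).
  by move=> nj; rewrite minE //; apply: mem_pickle_seq; exact: Hm.
have [[b Lb]|Lub] := pselect (exists b, forall x, L x -> x <= b).
  have [M [LM Mmax]] : exists M, L M /\ forall x, L x -> x <= M.
    have ex : exists m, `[< L m >] by exists x0; apply/asboolP.
    have ub i : `[< L i >] -> i <= b by move/asboolP/Lb.
    case: (ex_maxnP ex ub) => M /asboolP LM Mmax; exists M; split=> // x Lx.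
    by apply: Mmax; apply/asboolP.
  have [n1 HM] := initial_segment_cvg TL LM.
  have [s0 Hs] := stage_cvg (m + M).
  exists (guess (compl Z) m M), (maxn n0 (maxn n1 s0)); split=> [j nj|e LE].
    split; first by apply: minlt; lia.
    rewrite /learner_index minE; last lia.
    rewrite (maxdataE (m := M)).
    - apply: eq_guess; apply: Hs; have := size_initial_segment T j; lia.
    - apply: HM; lia.
    - by move=> x /(initial_segment_sub TL)/Mmax.
  (* The starts of the first and the last class of [interval Z e] belong to [L], which fixes the
     class indices of [m] and [M]. *)
  have [se cse _] := startP (compl Z) e.
  have Ls : L (start (compl Z) e) by rewrite LE /interval /= /member; lia.
  have La : L (a (cnt (compl Z) e + (e - start (compl Z) e))).
    by rewrite LE /interval /= /member (cnt_a ha Z0); lia.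
  move: Lm LM; rewrite {1 2}LE /interval /= /member => me Me.
  have ms := leq_cnt (compl Z) (mmin _ Ls).
  have Ma := Mmax _ La; rewrite (leq_a_cnt ha Z0) in Ma.
  by apply: guess_member; lia.
have /andP[am ma] := cntP ha Z0 m.
(* [u] is the last element of the class of [m]. The index of [K] is so large that a datum beyond [K]
   lifts [bound] to at least [u]. *)
set n1 := (cnt (compl Z) m).+1 in ma; pose u := (a n1).-1; pose K := a (n1 + u).
have cK : cnt (compl Z) K = n1 + u by rewrite cnt_a.
have ca : cnt (compl Z) (a n1) = n1 by rewrite cnt_a.
have aK : a n1 <= K by rewrite (leq_a_cnt ha Z0) cK leq_addr.
have cu : cnt (compl Z) u = cnt (compl Z) m.
  have : ~~ (n1 <= cnt (compl Z) u) by rewrite -(leq_a_cnt ha Z0); lia.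
  have /(leq_cnt (compl Z)) : m <= u by lia.
  by lia.
have [s0 Hs] := stage_cvg K.
have [x [Lx Kx]] : exists x, L x /\ K <= x.
  apply/not_existsP => KL; apply: Lub; exists K => x Lx.
  by rewrite leqNgt; apply/negP => /ltnW Kx; apply: (KL x).
have [nx Hx] := initial_segment_cvg TL Lx.
exists u, (maxn n0 (maxn nx s0)); split=> [j nj|e LE].
  split; first by apply: minlt; lia.
  rewrite /learner_index minE; last lia.
  set s := pickle _; set y := maxdata s.
  have Ky : K <= y by apply: leq_trans Kx _; apply: leq_maxdata; apply: Hx; lia.
  have sE z : z <= K -> cnt (stage r s) z = cnt (compl Z) z.
    move=> zK; apply: eq_cnt => i iz; apply: Hs; last lia.
    by have := size_initial_segment T j; rewrite -/s; lia.
  (* Beyond [K] the stage may still be wrong; monotonicity of [cnt] gives the lower bound that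
     suffices. *)
  have cy := leq_cnt (stage r s) Ky; rewrite sE // in cy.
  have cm := sE m; have csu := sE u; have csa := sE (a n1).
  apply: guessE; first by rewrite /bound; lia.
    by lia.
  move=> i /andP[ui _]; have : a n1 <= i by lia.
  by move=> /(leq_cnt (stage r s)); lia.
(* An interval lies below the boundary following its last class, so an unbounded [L] is not an
   interval. *)
exfalso; apply: Lub; exists (a (cnt (compl Z) e + (e - start (compl Z) e)).+1) => y.
rewrite LE /interval /= /member => ye; rewrite leqNgt; apply/negP => /ltnW.
have [se _ _] := startP (compl Z) e.
by rewrite (leq_a_cnt ha Z0); lia.
Qed.

Lemma interval_confidently_learnable (W : nat -> set nat) (zeta : nat -> nat -> Prop) :
  acceptable_numbering W ->
  (forall L, zeta_closed zeta L -> zeta_closure zeta L = L) ->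
  (forall e, zeta_closed zeta (interval Z e)) ->
  confidently_learnable W zeta (range (interval Z)).
Proof.
move=> [_ /(_ _ uniformly_re_interval)[h /computable_nat rh hW]] clK icl.
have hypE e : hypothesis W zeta (h e) = interval Z e.
  by rewrite /hypothesis -hW clK.
(* Without data the output stays [None], which gives convergence on texts for the empty set. *)
pose M (s : seq (option nat)) := let c := pickle s in
  if mindata c < c then Some (h (learner_index c)) else None.
have cvg L T x : text_for T L -> L x -> exists u n, (forall j, n <= j ->
    M (initial_segment T j) = Some (h u)) /\ forall e, L = interval Z e -> u = e.
  move=> TL Lx; have [u [n [Hu He]]] := learner_index_cvg TL Lx.
  by exists u, n; split=> // j /Hu[lt <-]; rewrite /M /= lt.
exists M; split.
- apply/computableE; exists (fun c => if mindata c < c then 2 ^ h (learner_index c) else 0).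
    apply: Rec1I; apply: rec_if; [|apply: Rec2_exp; [exact: rec_cst|apply: rh]|exact: rec_cst].
      by apply: Rec2_leq; [apply: Rec1_succ; apply: Rec1_mindata|]; rec_tac.
    by apply: rec_guess => //; [|apply: Rec1_mindata|apply: Rec1_maxdata]; rec_tac.
  move=> s; rewrite /M /=; case: ifP => // _.
  by rewrite -[RHS]muln1.
- move=> L T [e _ <-] TL; have [se cse _] := startP (compl Z) e.
  have [u [n [Hu /(_ e erefl) ue]]] : exists u n, (forall j, n <= j ->
      M (initial_segment T j) = Some (h u)) /\
      forall e', interval Z e = interval Z e' -> u = e'.
    by apply: (cvg _ _ (start (compl Z) e) TL); rewrite /interval /= /member; lia.
  by exists (h u), n; rewrite hypE ue in Hu *.
- move=> L T TL; have [[x Lx]|L0] := pselect (exists x, L x).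
    by have [u [n [Hu _]]] := cvg _ _ _ TL Lx; exists (Some (h u)), n.
  exists None, 0 => j _; rewrite /M /= mindata_none ?ltnn // => x.
  by apply/negP => /(initial_segment_sub TL) Lx; apply: L0; exists x.
Qed.
End Learner.

(** * No family is finitely learnable *)

(** Domination is assumed in [dense_simple] for some enumeration; this transfers it to the given
    one. *)
Lemma ascending_enumeration_unique Z a b : ~ Z 0 ->
  ascending_enumeration a (~` Z) -> ascending_enumeration b (~` Z) -> a = b.
Proof.
move=> Z0 ha hb; apply: funext => n; apply/eqP; rewrite eqn_leq.
rewrite (leq_a_cnt ha Z0) -(leq_a_cnt hb Z0) leqnn.
by rewrite (leq_a_cnt hb Z0) -(leq_a_cnt ha Z0) leqnn.
Qed.

Lemma eq_initial_segment T T' n :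
  (forall i, i < n -> T i = T' i) -> initial_segment T n = initial_segment T' n.
Proof. by move=> TT'; apply/eq_in_map => i; rewrite mem_iota => /TT'. Qed.

Section NoFinite.
Variables (Z : set nat) (a : nat -> nat).
Hypotheses (ha : ascending_enumeration a (~` Z)) (Z0 : ~ Z 0).
Hypothesis a_dom : forall f : nat -> nat, computable f ->
  exists N, forall n, N <= n -> f n < a n.
Variables (W : nat -> set nat) (zeta : nat -> nat -> Prop) (B : nat -> set nat).
Hypotheses (reB : uniformly_re B) (B_inj : injective B).
Hypothesis B_closed : forall e x y,
  cnt (compl Z) x = cnt (compl Z) y -> B e x -> B e y.

(** The numbers below [a n] fill exactly the first [n] classes, so this finite trace determines the
    closed set [B e] there. *)
Let agree n (e : nat) : {set 'I_n} := [set k : 'I_n | `[< B e (a k) >]]%SET.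

Let agreeP n i j x : agree n i = agree n j -> x < a n -> B i x -> B j x.
Proof.
move=> ij; rewrite ltnNge (leq_a_cnt ha Z0) -ltnNge => xn Bi.
have cx : cnt (compl Z) (a (cnt (compl Z) x)) = cnt (compl Z) x by rewrite (cnt_a ha Z0).
apply: (B_closed cx).
have : Ordinal xn \in agree n i by rewrite inE; apply/asboolP; apply: B_closed Bi.
by rewrite ij inE => /asboolP.
Qed.

(** Pigeonhole: [2 ^ n + 1] indices, but only [2 ^ n] traces. *)
Let agree_collision n : exists i j : nat,
  [/\ i <= 2 ^ n, j <= 2 ^ n, i <> j & agree n i = agree n j].
Proof.
apply: contrapT => H.
have inj : injective (fun e : 'I_(2 ^ n).+1 => agree n e).
  move=> i j ij; apply/val_inj/eqP/negPn/negP => /eqP nij.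
  by apply: H; exists i, j; split=> //; rewrite -ltnS.
have := leq_card _ inj; rewrite card_ord -cardsT -powersetT card_powerset cardsT card_ord.
by rewrite ltnn.
Qed.

(** One enumeration of the pairs serves every [e], pausing at pairs with another first component. If
    there were no pairs, all [B e] would be empty, against injectivity. *)
Lemma enumerated_texts : exists T : nat -> text,
  (forall e, text_for (T e) (B e)) /\
  Rec2 (fun e n => pickle (initial_segment (T e) n)).
Proof.
case: reB => [B0|[f /computableE[g rg fg] fB]].
  have /B_inj// : B 0 = B 1.
  have BE e : B e = set0.
    by apply/seteqP; split=> // x Bx; have : [set p | B p.1 p.2] (e, x) by []; rewrite B0.
  by rewrite !BE.
exists (fun e i => if (f i).1 == e then Some (f i).2 else None); split.
  move=> e; apply/seteqP; split=> [x [i]|x Bx] /=.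
    case: eqP => // <- [<-].
    by have : range f (f i) by [exists i]; rewrite fB.
  have : range f (e, x) by rewrite fB.
  by case=> i _ fi; exists i; rewrite fi eqxx.
apply: Rec2I; apply: (@rec_in_ext _ (fun v => CodeSeq.code (mkseq (fun i =>
    if headc (g i) == nth 0 v 0 then 2 ^ headc (tailc (g i)) else 0) (nth 0 v 1)))).
  move=> v _; apply: (congr1 CodeSeq.code); rewrite /initial_segment /mkseq -map_comp.
  apply: eq_map => i /=; rewrite -[i in g i]/(pickle i) -fg pickle_pair addnn.
  rewrite headcE tailcE headc_exp.
  by case: ifP => // _; rewrite -[LHS]muln1.
apply: (rec_mkseq (F := fun i v => if headc (g i) == nth 0 v 0
  then 2 ^ headc (tailc (g i)) else 0)); first by rec_tac.
by rec_tac; apply: rg; rec_tac.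
Qed.

(** A finite learner never revises its first conjecture, which must therefore be correct. *)
Lemma first_output M L T t : M (initial_segment T t) <> None ->
  (forall m, m < t -> M (initial_segment T m) = None) ->
  (exists n e,
        [/\ forall m, m < n -> M (initial_segment T m) = None,
            forall j, n <= j ->
              M (initial_segment T j) = M (initial_segment T n),
            M (initial_segment T n) = Some e &
            hypothesis W zeta e = L]) ->
  exists2 e, M (initial_segment T t) = Some e & hypothesis W zeta e = L.
Proof.
move=> Mt tN [n [e [nN _ Mn <-]]]; exists e => //.
have [nt|tn|<-//] := ltngtP n t; first by rewrite tN in Mn.
by case: Mt; exact: nN.
Qed.

Lemma not_finitely_learnable : ~ finitely_learnable W zeta (range B).
Proof.
move=> [M [/computableE[g rg Mg] HM]]; have [T [TB rT]] := enumerated_texts.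
have MT e : exists n, M (initial_segment (T e) n) != None.
  have [|n [x [_ _ Mn _]]] := HM (B e) (T e) _ (TB e); first by exists e.
  by exists n; rewrite Mn.
pose t e := ex_minn (MT e).
have tP e : M (initial_segment (T e) (t e)) <> None.
  by rewrite /t; case: ex_minnP => n /eqP.
have tmin e m : m < t e -> M (initial_segment (T e) m) = None.
  rewrite /t; case: ex_minnP => n _ nmin mn; apply/eqP/negPn/negP => /nmin.
  by rewrite leqNgt mn.
(* Each text [T e] eventually elicits a conjecture, so the minimization is regular. *)
have rt : Rec1 t.
  have gE s : (g (pickle s) == 0) = (M s == None).
    rewrite -Mg; case: (M s) => // x; rewrite -[pickle _]/(2 ^ x * 1) muln1.
    by rewrite expn_eq0.
  apply: (@Rec1_mu (fun n e => ~~ (g (pickle (initial_segment (T e) n)) == 0))).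
  - rec_tac; apply: rg; apply: rT; rec_tac.
  - by move=> e; rewrite gE; apply/eqP; exact: tP.
  - by move=> e n /tmin; rewrite gE negbK => ->.
pose D e := pickle (initial_segment (T e) (t e)).
have rD : Rec1 D by move=> k f rf; apply: rT => //; apply: rt.
(* The sum bounds [D e] for all [2 ^ k + 1] indices of the pigeonhole argument at once. *)
have [|N HN] := a_dom (f := fun k => \sum_(e < (2 ^ k).+1) D e).
  apply/computable_nat; apply: Rec1I.
  by apply: (rec_sum (F := fun e _ => D e)); [|apply: rD]; rec_tac.
have [i [j [iN jN nij ij]]] := agree_collision N; apply: nij; apply: B_inj.
have DN e : e <= 2 ^ N -> D e < a N.
  move=> eN; apply: leq_ltn_trans (HN N (leqnn N)).
  by rewrite (bigD1 (Ordinal (eN : e < (2 ^ N).+1))) //= leq_addr.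
(* The segment of [T i] that elicits the conjecture, continued by [T j]. Its data lie below [a N],
   where [B i] and [B j] agree, so [T'] is a text for [B j] on which the learner conjectures
   [B i]. *)
pose T' m := if m < t i then T i m else T j (m - t i).
have TB' : text_for T' (B j).
  apply/seteqP; split=> [x [m]|x].
    rewrite /T'; case: ltnP => [mt Tm|_ Tm]; last by rewrite -(TB j); exists (m - t i).
    apply: (agreeP ij); last by rewrite -(TB i); exists m.
    apply: ltn_trans (DN i iN); apply: mem_pickle_seq.
    by apply/initial_segmentP; exists m.
  rewrite -{1}(TB j) => -[m Tm]; exists (m + t i).
  by rewrite /T' ltnNge leq_addl /= addnK.
have segE m : m <= t i -> initial_segment T' m = initial_segment (T i) m.
  by move=> mt; apply: eq_initial_segment => k km; rewrite /T' (leq_trans km mt).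
have [|e Me <-] := first_output (@tP i) (tmin i) (HM (B i) _ _ (TB i)); first by exists i.
have [|||e'] := first_output (M := M) (T := T') (t := t i) _ _ (HM (B j) _ _ TB').
- by rewrite segE.
- by move=> m mt; rewrite segE ?tmin // ltnW.
- by exists j.
by rewrite segE // Me => -[->].
Qed.
End NoFinite.

Theorem theorem10 (W : nat -> set nat) (hW : acceptable_numbering W)
    (Z : set nat) (hZ : dense_simple Z) (hZ0 : ~ Z 0)
    (a : nat -> nat) (ha : ascending_enumeration a (~` Z))
    (zeta : nat -> nat -> Prop)
    (hzeta : forall x y, zeta x y <->
       exists n, a n <= minn x y /\ minn x y <= maxn x y /\
                 maxn x y < a n.+1) :
  [/\ positive_equivalence zeta,
      exists C : set (set nat),
        zeta_family zeta C /\ confidently_learnable W zeta C &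
      ~ exists C : set (set nat),
          zeta_family zeta C /\ finitely_learnable W zeta C].
Proof.
have [/re_stages[r [rr r_mono Zr]] _ [b hb b_dom]] := hZ.
have ab := ascending_enumeration_unique hZ0 ha hb; rewrite -{}ab in b_dom.
split.
- split; [exact: zeta_equivalence ha hZ0 zeta hzeta| |exact: infinite_eq_classes ha hZ0 zeta hzeta].
  (* Stages have extra boundaries, so numbers in one class at some stage are truly equivalent;
     conversely, the boundaries up to both numbers settle. *)
  have -> : [set p : nat * nat | zeta p.1 p.2] =
      [set p | exists s, cnt (stage r s) p.1 == cnt (stage r s) p.2].
    apply/seteqP; split=> -[x y] /=; rewrite (zetaE ha hZ0 hzeta).
      have [s Hs] := stage_cvg r_mono Zr (maxn x y) => xy; exists s.
      by rewrite !(eq_cnt (Q := compl Z)) ?xy // => z zx; apply: Hs => //; lia.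
    wlog xy : x y / x <= y => [H|] [s /eqP sxy].
      have [|/ltnW] := leqP x y; first by move/H; apply; exists s; apply/eqP.
      by move/H => -> //; exists s; apply/eqP.
    have := cnt_sub (@compl_stage Z r Zr s) xy; have := leq_cnt (compl Z) xy.
    by lia.
  apply: (re_pairs (R := fun x y s => cnt (stage r s) x == cnt (stage r s) y)).
  by move=> k f g h rf rg rh; apply: Rec2_eq; apply: Rec2_cnt.
- have icl := interval_closed ha hZ0 hzeta.
  exists (range (interval Z)); split.
    split; [|by move=> _ [e _ <-]|].
      by apply: (infinite_range_inj (interval_inj ha hZ0)) => e; exists e.
    exists (interval Z); split=> //; last exact: interval_inj ha hZ0.
    exact: uniformly_re_interval rr r_mono Zr.
  apply: (interval_confidently_learnable ha hZ0 rr r_mono Zr hW) => //.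
  exact: zeta_closure_id ha hZ0 zeta hzeta.
- move=> [C [[_ Ccl [B [reB B_inj BC]]]]]; rewrite -{}BC in Ccl *.
  apply: (not_finitely_learnable ha hZ0 b_dom) => //.
  move=> e; apply/(zeta_closedE ha hZ0 hzeta); apply: Ccl.
  by exists e.
Qed.
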